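(* Let $\mathbf{L}\in\mathbb{R}^{n\times n}$ be symmetric and let $\phi$ be a positive function on an interval $[0,\Lambda]$, $\Lambda>0$, which contains the spectrum of $\mathbf{L}$. Let $\mathrm{E}_W\in\mathbb{R}^{n\times N}$ be a block of $N$ distinct canonical unit vectors of $\mathbb{R}^n$ and $\mathrm{y}=[y_1,\ldots,y_N]^*\in\mathbb{R}^N$. Then, for every $m\ge1$ and $\gamma\ge0$, there exists a unique RLS kernel predictor $y^{(\mathrm{cbl})}$, defined by $y^{(\mathrm{cbl})}=p_{\phi,m-1}^{(\mathrm{cbl})}(\mathbf{L})\mathrm{E}_W\,\mathrm{c}^{(\mathrm{cbl})}$ with the coefficients $\mathrm{c}^{(\mathrm{cbl})}\in\mathbb{R}^N$ determined as the solution of the linear system $$\left(\mathrm{E}_W^*\,p_{\phi,m-1}^{(\mathrm{cbl})}(\mathbf{L})\mathrm{E}_W+\gamma N\mathbf{I}_N\right)\mathrm{c}^{(\mathrm{cbl})}=\mathrm{y},$$ i.e. this linear system has a unique solution. The predictor $y^{(\mathrm{cbl})}$ can be written as a linear combination of the columns $\{q_1,\ldots,q_{mN}\}$ of $[\mathrm{Q}_1,\ldots,\mathrm{Q}_m]$ as $$y^{(\mathrm{cbl})}=[\mathrm{Q}_1,\ldots,\mathrm{Q}_m]\,\phi(\mathbf{H}_m)\,\mathrm{F}_1\,\mathrm{c}^{(\mathrm{cbl})}.$$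
   Context: $A^*$ denotes the transpose of a real matrix $A$. For a symmetric matrix $M$ with spectrum in $[0,\Lambda]$, $\phi(M)$ is defined through the spectral decomposition of $M$. $\mathrm{E}_W=[e_{\mathrm{w}_1},\ldots,e_{\mathrm{w}_N}]$, the unit vectors corresponding to $N$ distinct sampling nodes of a graph with $n$ vertices. RLS stands for regularized least squares. Classical block Lanczos method. Set $\mathrm{Q}_0=0$, $\mathrm{H}_{0,1}=0$, $\mathrm{Q}_1=\mathrm{E}_W$. For $k=1,2,\ldots$ put $\mathrm{X}=\mathbf{L}\mathrm{Q}_k-\mathrm{Q}_{k-1}\mathrm{H}_{k-1,k}$, $\mathrm{H}_{k,k}=\mathrm{Q}_k^*\mathrm{X}$, replace $\mathrm{X}$ by $\mathrm{X}-\mathrm{Q}_k\mathrm{H}_{k,k}$, compute a reduced QR decomposition $\mathrm{X}=\mathrm{Q}_{k+1}\mathrm{H}_{k+1,k}$ with $\mathrm{Q}_{k+1}\in\mathbb{R}^{n\times N}$ having orthonormal columns and $\mathrm{H}_{k+1,k}\in\mathbb{R}^{N\times N}$ upper triangular, and set $\mathrm{H}_{k,k+1}=\mathrm{H}_{k+1,k}^*$. It is assumed that no breakdown occurs, i.e. the blocks $\mathrm{H}_{k+1,k}$, $k=1,\ldots,m-1$, needed to generate $\mathrm{Q}_1,\ldots,\mathrm{Q}_m$ are invertible. Let $\mathbf{H}_m\in\mathbb{R}^{mN\times mN}$ be the block tridiagonal matrix with diagonal blocks $\mathrm{H}_{k,k}$ ($1\le k\le m$), subdiagonal blocks $\mathrm{H}_{k+1,k}$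 and superdiagonal blocks $\mathrm{H}_{k,k+1}$ ($1\le k\le m-1$), and let $\mathrm{F}_1\in\mathbb{R}^{mN\times N}$ have $\mathbf{I}_N$ as its first $N\times N$ block and zeros elsewhere. The output is $$p_{\phi,m-1}^{(\mathrm{cbl})}(\mathbf{L})\mathrm{E}_W := [\mathrm{Q}_1,\ldots,\mathrm{Q}_m]\,\phi(\mathbf{H}_m)\,\mathrm{F}_1 ,$$ where the left-hand side is to be read as one symbol for an $n\times N$ matrix. *)

(* Defs.v *)
From HB Require Import structures.
From mathcomp Require Import all_boot all_order all_algebra.
From mathcomp Require Import boolp classical_sets reals.

Set Implicit Arguments.
Unset Strict Implicit.
Unset Printing Implicit Defensive.

Import Order.TTheory GRing.Theory Num.Theory.
Local Open Scope ring_scope.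

(* A spectral decomposition M = V diag(d) V^T, with V orthogonal. *)
Definition spectral_decomposition (R : realType) (p : nat) (M : 'M[R]_p)
    (Vd : 'M[R]_p * 'rV[R]_p) : Prop :=
  Vd.1^T *m Vd.1 = 1%:M /\ M = Vd.1 *m diag_mx Vd.2 *m Vd.1^T.

(* phi(M) = V diag(phi(d)) V^T for a chosen spectral decomposition of M; the
   choice is immaterial by mxfunE. Every symmetric M has a decomposition; for
   an M without one, the value is that of the default pair (1, 0). *)
Definition mxfun (R : realType) (p : nat) (phi : R -> R) (M : 'M[R]_p) : 'M[R]_p :=
  let Vd := xget (1%:M, 0) [set Vd | spectral_decomposition M Vd]%classic in
  Vd.1 *m diag_mx (map_mx phi Vd.2) *m Vd.1^T.

Lemma mxfunE (R : realType) (p : nat) (phi : R -> R) (M V : 'M[R]_p) (d : 'rV[R]_p) :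
  spectral_decomposition M (V, d) ->
  mxfun phi M = V *m diag_mx (map_mx phi d) *m V^T.
Proof.
move=> sVd; rewrite /mxfun.
set S := [set _ | _]%classic.
have [UU ME] : S (xget (1%:M, 0) S) by apply: xgetPex; exists (V, d).
case: (xget _ _) UU ME => U e /= UU ME.
case: sVd => /= VV ME'.
have UU' := mulmx1C UU; have VV' := mulmx1C VV.
pose W := U^T *m V.
have WE : W *m diag_mx d = diag_mx e *m W.
  have : U^T *m M *m V = U^T *m M *m V by [].
  rewrite {1}ME' ME /W !mulmxA UU mul1mx.
  by rewrite -!mulmxA VV mulmx1 !mulmxA.
have WphiE : W *m diag_mx (map_mx phi d) = diag_mx (map_mx phi e) *m W.
  apply/matrixP => i j.
  move/matrixP/(_ i j): WE.
  rewrite !mul_mx_diag !mul_diag_mx !mxE.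
  set w := \sum_(_ < _) _.
  have [-> _|w0] := eqVneq w 0; first by rewrite mul0r mulr0.
  by rewrite mulrC => /(mulIf w0) ->; rewrite mulrC.
rewrite -[LHS]mulmx1 -VV' mulmxA -[X in X *m V]mulmxA.
congr (_ *m _); rewrite -!mulmxA -/W -WphiE /W.
by rewrite !mulmxA UU' mul1mx.
Qed.

(* The block [e_{w 0}, ..., e_{w (N-1)}] of canonical unit vectors of R^n. *)
Definition unit_block (R : realType) (n N : nat) (w : 'I_N -> 'I_n) : 'M[R]_(n, N) :=
  \matrix_(i, j) (i == w j)%:R.

(* is_trig_mx means lower triangular. *)
Definition reduced_qr (R : realType) (n N : nat) (X Q : 'M[R]_(n, N)) (T : 'M[R]_N) : Prop :=
  [/\ X = Q *m T, Q^T *m Q = 1%:M & is_trig_mx T^T].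

(* Q and H are the blocks Q_0, ..., Q_m and H_{k,l} produced by m steps of the
   method started from the block E. A QR decomposition is not unique, hence a
   relation that admits any choice of it. Nothing is required of the remaining
   values of Q and H. *)
Record block_lanczos (R : realType) (n N : nat) (L : 'M[R]_n) (E : 'M[R]_(n, N)) (m : nat)
    (Q : nat -> 'M[R]_(n, N)) (H : nat -> nat -> 'M[R]_N) : Prop := BlockLanczos {
  bl_Q0 : Q 0%N = 0;
  bl_H01 : H 0%N 1%N = 0;
  bl_Q1 : Q 1%N = E;
  bl_diag : forall k : nat, (1 <= k <= m)%N ->
    H k k = (Q k)^T *m (L *m Q k - Q k.-1 *m H k.-1 k);
  bl_qr : forall k : nat, (1 <= k < m)%N ->
    reduced_qr (L *m Q k - Q k.-1 *m H k.-1 k - Q k *m H k k) (Q k.+1) (H k.+1 k);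
  bl_super : forall k : nat, (1 <= k < m)%N -> H k k.+1 = (H k.+1 k)^T
}.

Definition no_breakdown (R : realType) (N m : nat) (H : nat -> nat -> 'M[R]_N) : Prop :=
  forall k : nat, (1 <= k < m)%N -> H k.+1 k \in unitmx.

(* Ordinals start at 0, so that the ordinal i stands for the block index i + 1;
   the dimension m * N appears as \sum_(i < m) N. *)
Definition lanczos_basis (R : realType) (n N m : nat) (Q : nat -> 'M[R]_(n, N)) :
    'M[R]_(n, \sum_(i < m) N) :=
  \mxrow_(j < m) Q j.+1.

Definition lanczos_tridiag (R : realType) (N m : nat) (H : nat -> nat -> 'M[R]_N) :
    'M[R]_(\sum_(i < m) N) :=
  \mxblock_(i < m, j < m)
    (if [|| i == j :> nat, i == j.+1 :> nat | j == i.+1 :> nat]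
     then H i.+1 j.+1 else 0 : 'M[R]_N).

Definition first_block (R : realType) (N m : nat) : 'M[R]_(\sum_(i < m) N, N) :=
  \mxcol_(i < m) (if i == 0%N :> nat then 1%:M else 0 : 'M[R]_N).

(* The matrix p_{phi,m-1}^(cbl)(L) E_W. *)
Definition cbl_output (R : realType) (n N m : nat) (phi : R -> R)
    (Q : nat -> 'M[R]_(n, N)) (H : nat -> nat -> 'M[R]_N) : 'M[R]_(n, N) :=
  lanczos_basis m Q *m mxfun phi (lanczos_tridiag m H) *m first_block R N m.

Definition rls_coefficients (R : realType) (n N : nat) (E P : 'M[R]_(n, N)) (gamma : R)
    (y c : 'cV[R]_N) : Prop :=
  (E^T *m P + (gamma * N%:R)%:M) *m c = y.

Definition rls_predictor (R : realType) (n N : nat) (E P : 'M[R]_(n, N)) (gamma : R)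
    (y : 'cV[R]_N) (u : 'cV[R]_n) : Prop :=
  exists2 c : 'cV[R]_N, rls_coefficients E P gamma y c & u = P *m c.

(* Main.v *)
Require Import Defs.
From mathcomp Require Import all_boot all_order all_algebra.
From mathcomp Require Import boolp classical_sets reals.
From mathcomp Require Import complex.

Import Order.TTheory GRing.Theory Num.Theory.
Local Open Scope ring_scope.

(** The Gram matrix that determines the coefficients is a compression of
    [phi] of the block tridiagonal matrix, hence positive definite.

    Let [B] be the matrix of all Lanczos vectors, [T] the block tridiagonal
    matrix and [F] the first block column of the identity. The three-term
    recurrence, together with the invertibility of the off-diagonal blocks,
    makes the columns of [B] orthonormal ([lanczos_basis_orthonormal]) and
    gives [T = B^T L B] ([lanczos_tridiagE]). Two consequences follow.

    First, [T] is a compression of [L], so each of its eigenvalues is a Rayleigh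
    quotient of [L] and lies in the interval that contains the spectrum of [L]
    ([compression_spectrum]). The values of [phi] at these eigenvalues are thus
    positive, and [phi(T)] is positive definite
    ([mxfun_quadratic_form_gt0]).

    Second, [E = B F] and [F = B^T E], so that [E^T P = E^T B phi(T) F] is
    [F^T phi(T) F]; as [F] is injective ([E] has orthonormal columns), this
    matrix is positive definite too. Adding the nonnegative multiple
    [gamma N] of the identity keeps it so, and a positive definite matrix is
    invertible: the coefficients exist and are unique, and so is the predictor.
    Its expansion in the Lanczos vectors is a matter of associativity.

    The meaning of [phi(T)] and the bound on Rayleigh quotients both rest on
    the spectral theorem for real symmetric matrices
    ([symmetric_spectral_decomposition]). Its proof is by deflation: a real
    eigenvalue comes from the complex spectral theorem, and a Householder
    reflection moves a unit eigenvector to the first coordinate axis. *)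

(** * The real spectral theorem *)

Lemma row_sqnormE {R : realDomainType} {p : nat} (v : 'rV[R]_p) :
  (v *m v^T) 0 0 = \sum_i v 0 i ^+ 2.
Proof. by rewrite mxE; apply: eq_bigr => i _; rewrite mxE. Qed.

Lemma row_sqnorm_eq0 {R : realDomainType} {p : nat} (v : 'rV[R]_p) :
  (v *m v^T) 0 0 = 0 -> v = 0.
Proof.
rewrite row_sqnormE => /eqP; rewrite psumr_eq0 => [|i _]; last exact: sqr_ge0.
move/allP => v0; apply/rowP => i; rewrite mxE; apply/eqP.
by rewrite -sqrf_eq0; apply: v0; rewrite mem_index_enum.
Qed.

(** Over the complex closure the matrix is Hermitian, hence unitarily
    diagonalizable with a real diagonal; a real root of its characteristic
    polynomial is then a root over the base field. *)
Lemma symmetric_has_eigenvalue {R : rcfType} {p : nat} (M : 'M[R]_p.+1) :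
  M^T = M -> exists a : R, eigenvalue M a.
Proof.
move=> Msym; pose A := map_mx (real_complex R) M.
have Aherm : A \is hermsymmx.
  apply: realsym_hermsym; last first.
    by apply/mxOverP => i j; rewrite mxE; apply/complex_realP; exists (M i j).
  by apply/is_hermitianmxP; rewrite expr0 scale1r map_mx_id // map_trmx Msym.
have Adiag := orthomx_spectralP (hermitian_normalmx Aherm).
have /mxOverP/(_ 0 0)/complex_realP[a da] := hermitian_spectral_diag_real Aherm.
have Punit := spectral_unit A.
(* The first row of the diagonalizing matrix is the eigenvector. *)
have P0 : row 0 (spectralmx A) != 0.
  apply/eqP => P0; have := oner_neq0 (complex R); apply/negP; rewrite negbK.
  have /matrixP/(_ 0 0) : row 0 (spectralmx A *m invmx (spectralmx A)) = 0.
    by rewrite row_mul P0 mul0mx.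
  by rewrite mulmxV // !mxE eqxx => /eqP.
exists a; rewrite eigenvalue_root_char -(fmorph_root (real_complex R)).
rewrite map_char_poly -/A -eigenvalue_root_char.
apply/eigenvalueP; exists (row 0 (spectralmx A)) => //.
rewrite [X in _ *m X]Adiag -row_mul !mulmxA mulmxV // mul1mx row_mul.
by rewrite row_diag_mx -scalemxAl da [in RHS]rowE.
Qed.

(** The Householder reflection in the hyperplane orthogonal to [v - u]
    exchanges two vectors [u] and [v] of the same length; if they are equal, the
    identity serves instead. *)
Lemma orthogonal_map_exists {R : realFieldType} {p : nat} (u v : 'rV[R]_p) :
  u *m u^T = v *m v^T -> exists2 U : 'M[R]_p, U^T *m U = 1%:M & u *m U = v.
Proof.
move=> uv; pose w := v - u; pose s := (w *m w^T) 0 0.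
have [s0|s0] := eqVneq s 0.
  exists 1%:M; first by rewrite trmx1 mulmx1.
  by rewrite mulmx1; apply/esym/eqP; rewrite -subr_eq0; apply/eqP/row_sqnorm_eq0.
have vu : v *m u^T = u *m v^T.
  by rewrite -[LHS]trmxK trmx_mul trmxK [u *m _]mx11_scalar tr_scalar_mx.
have sE : w *m w^T = s%:M by rewrite -mx11_scalar.
(* Equal lengths give |v - u|^2 = 2 |u|^2 - 2 <u, v> = - 2 <u, v - u>. *)
have uw : u *m w^T = (- (s / 2))%:M.
  have: w *m w^T = -2 *: (u *m w^T).
    rewrite /w linearB /= mulmxBr !mulmxBl mulmxBr -uv vu opprB scalerBr.
    by rewrite !scaleNr !scaler_nat !mulr2n opprK opprD addrACA addrC [- _ + _]addrC.
  rewrite sE => /(congr1 (fun A => (-2)^-1 *: A)); rewrite scalerA mulVf ?scale1r.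
    by move=> <-; rewrite scale_scalar_mx invrN mulNr mulrC.
  by rewrite oppr_eq0 pnatr_eq0.
pose U : 'M[R]_p := 1%:M - (2 / s) *: (w^T *m w).
have UT : U^T = U by rewrite linearB linearZ /= trmx1 trmx_mul trmxK.
exists U; last first.
  rewrite mulmxBr mulmx1 -scalemxAr mulmxA uw mul_scalar_mx scalerA mulrN.
  by rewrite mulrA divfK // divff ?pnatr_eq0 // scaleN1r opprK addrC subrK.
rewrite UT /U mulmxBr mulmx1 -scalemxAr mulmxBl mul1mx -scalemxAl.
have -> : w^T *m w *m (w^T *m w) = s *: (w^T *m w).
  by rewrite -mulmxA [w *m (_ *m _)]mulmxA sE mul_scalar_mx -scalemxAr.
rewrite scalerA divfK // -addrA -opprD -scalerDr.
by rewrite scaler_nat mulr2n [_ + (_ - _)]addrA subrr scaler0 subr0.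
Qed.

Lemma symmetric_unit_eigenvector {R : rcfType} {p : nat} (M : 'M[R]_p.+1) :
  M^T = M -> exists (a : R) (v : 'rV_p.+1), v *m v^T = 1%:M /\ v *m M = a *: v.
Proof.
move=> /symmetric_has_eigenvalue[a /eigenvalueP[v vM v0]].
have n_gt0 : 0 < (v *m v^T) 0 0.
  rewrite lt_neqAle eq_sym row_sqnormE sumr_ge0 ?andbT => [|i _]; last exact: sqr_ge0.
  by rewrite -row_sqnormE; apply: contra v0 => /eqP/row_sqnorm_eq0 ->.
set r := (v *m v^T) 0 0 in n_gt0.
exists a, ((Num.sqrt r)^-1 *: v); split; last by rewrite -scalemxAl vM !scalerA mulrC.
rewrite linearZ /= -scalemxAl -scalemxAr scalerA -invfM -expr2 sqr_sqrtr ?ltW //.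
by rewrite [v *m _]mx11_scalar -/r scale_scalar_mx mulVf ?gt_eqF.
Qed.

(** An eigenvector on the first axis makes the first row diagonal, and symmetry
    does the same for the first column; this is the deflation step. *)
Lemma symmetric_block_eigenvector {R : pzRingType} {p : nat} (M : 'M[R]_(1 + p)) (a : R) :
  M^T = M -> delta_mx 0 0 *m M = a *: delta_mx (0 : 'I_1) 0 ->
  M = block_mx a%:M 0 0 (drsubmx M).
Proof.
move=> Msym eM.
have M0 j : M 0 j = a *+ (j == 0).
  by move/rowP/(_ j): eM; rewrite -rowE !mxE eqxx mulr_natr.
have ord0L (i : 'I_1) : lshift p i = 0 by apply: val_inj; rewrite ord1.
rewrite -[LHS]submxK; congr block_mx; apply/matrixP => i j; rewrite !mxE ?ord0L.
- by rewrite M0 !ord1.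
- by rewrite M0.
- by rewrite -Msym mxE M0.
Qed.

(** Deflation: in an orthonormal basis whose first vector is an eigenvector, the
    matrix is block diagonal, and the remaining block is symmetric of smaller
    size. *)
Lemma symmetric_spectral_decomposition {R : realType} {p : nat} (M : 'M[R]_p) :
  M^T = M -> exists Vd, spectral_decomposition M Vd.
Proof.
elim: p => [|p IHp] in M *.
  by exists (1%:M, 0); split; [rewrite trmx1 mulmx1 | rewrite [LHS]thinmx0 [RHS]thinmx0].
move=> Msym; have [a [v [v1 vM]]] := symmetric_unit_eigenvector M Msym.
have [|U UU eU] := orthogonal_map_exists (delta_mx 0 0) v.
  by rewrite v1 trmx_delta mul_delta_mx [LHS]mx11_scalar mxE.
have UU' := mulmx1C UU.
pose N : 'M[R]_(1 + p) := U *m M *m U^T.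
have Nsym : N^T = N by rewrite /N !trmx_mul trmxK Msym mulmxA.
have NE : N = block_mx a%:M 0 0 (drsubmx N).
  apply: symmetric_block_eigenvector => //.
  by rewrite /N !mulmxA eU vM -scalemxAl -eU -mulmxA UU' mulmx1.
have [|[V d] [/= VV VE]] := IHp (drsubmx N); first by rewrite trmx_drsub Nsym.
pose W : 'M[R]_(1 + p) := block_mx 1%:M 0 0 V.
have WW : W^T *m W = 1%:M.
  rewrite /W tr_block_mx mulmx_block !trmx0 trmx1.
  by rewrite !(mulmx0, mul0mx, mulmx1, addr0, add0r) VV -scalar_mx_block.
exists (U^T *m W, row_mx a%:M d); split => /=.
  by rewrite trmx_mul trmxK -mulmxA [U *m _]mulmxA UU' mul1mx.
rewrite trmx_mul trmxK -!mulmxA [W *m _]mulmxA [W *m _ *m _]mulmxA.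
suff -> : W *m diag_mx (row_mx a%:M d) *m W^T = N.
  by rewrite /N !mulmxA UU mul1mx -mulmxA UU mulmx1.
rewrite NE VE /W tr_block_mx diag_mx_row !mulmx_block !trmx0 trmx1.
rewrite !(mulmx0, mul0mx, mulmx1, mul1mx, addr0, add0r).
by congr block_mx; apply/matrixP => i j; rewrite !mxE !ord1.
Qed.

(** * Quadratic forms and compressions *)

Lemma quadratic_form_spectral {R : realType} {p : nat} (M V : 'M[R]_p) d (z : 'cV_p) :
  spectral_decomposition M (V, d) ->
  (z^T *m M *m z) 0 0 = \sum_i d 0 i * (V^T *m z) i 0 ^+ 2.
Proof.
case=> /= _ ->; rewrite !mulmxA -[_ *m _ *m z]mulmxA.
rewrite -[z^T *m V]trmxK trmx_mul trmxK mul_mx_diag !mxE.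
by apply: eq_bigr => i _; rewrite !mxE expr2 mulrAC mulrC.
Qed.

Lemma quadratic_form_orthogonal {R : realType} {p : nat} (V : 'M[R]_p) (z : 'cV_p) :
  V^T *m V = 1%:M -> (z^T *m z) 0 0 = \sum_i (V^T *m z) i 0 ^+ 2.
Proof.
move=> /mulmx1C VV; rewrite -[z^T]mulmx1 -VV.
rewrite (quadratic_form_spectral _ V (const_mx 1)).
  by apply: eq_bigr => i _; rewrite mxE mul1r.
by split=> /=; [exact: mulmx1C | rewrite diag_const_mx mulmx1].
Qed.

Lemma spectral_decomposition_eigenvalue {R : realType} {p : nat} (M V : 'M[R]_p) d i :
  spectral_decomposition M (V, d) -> eigenvalue M (d 0 i).
Proof.
case=> /= VV ->; apply/eigenvalueP; exists (row i V^T).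
  by rewrite -row_mul !mulmxA VV mul1mx row_mul row_diag_mx -scalemxAl -rowE.
apply/eqP => V0; have := oner_neq0 R; apply/negP; rewrite negbK.
have /matrixP/(_ 0 i) : row i (V^T *m V) = 0 by rewrite row_mul V0 mul0mx.
by rewrite VV !mxE eqxx => /eqP.
Qed.

Lemma quadratic_form_col {R : pzRingType} {n p : nat} (A : 'M[R]_n) (V : 'M[R]_(n, p)) i :
  ((col i V)^T *m A *m col i V) 0 0 = (V^T *m A *m V) i i.
Proof. by rewrite tr_col -!row_mul colE mulmxA -colE !mxE. Qed.

(** An eigenvalue of the compression is the Rayleigh quotient of [L] at the image
    under [B] of a unit eigenvector, and this image is again a unit vector. In
    an eigenbasis of [L] the quotient is a convex combination of eigenvalues
    of [L]. *)
Lemma compression_spectrum {R : realType} {n p : nat} (L : 'M[R]_n) (B : 'M[R]_(n, p))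
    (a b : R) (V : 'M[R]_p) (d : 'rV[R]_p) i :
  L^T = L -> (forall x, eigenvalue L x -> a <= x <= b) -> B^T *m B = 1%:M ->
  spectral_decomposition (B^T *m L *m B) (V, d) -> a <= d 0 i <= b.
Proof.
move=> Lsym Lspec BB [/= VV CE].
have [[U l] Ul] := symmetric_spectral_decomposition L Lsym.
pose z := col i (B *m V).
have dE : d 0 i = \sum_j l 0 j * (U^T *m z) j 0 ^+ 2.
  rewrite -(quadratic_form_spectral _ _ _ z Ul) quadratic_form_col trmx_mul !mulmxA.
  rewrite -[_ *m L]mulmxA -[_ *m B]mulmxA CE !mulmxA VV mul1mx -mulmxA VV mulmx1.
  by rewrite mxE eqxx.
have zz : \sum_j (U^T *m z) j 0 ^+ 2 = 1.
  rewrite -quadratic_form_orthogonal ?Ul.1 //.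
  rewrite -[z^T]mulmx1 quadratic_form_col mulmx1 trmx_mul.
  by rewrite -mulmxA [B^T *m _]mulmxA BB mul1mx VV mxE eqxx.
have lab j : a <= l 0 j <= b by apply/Lspec/spectral_decomposition_eigenvalue/Ul.
rewrite dE -[a]mulr1 -[b]mulr1 -zz !mulr_sumr; apply/andP; split;
  by apply: ler_sum => j _; rewrite ler_wpM2r ?sqr_ge0 //; case/andP: (lab j).
Qed.

Lemma mxfun_quadratic_form_gt0 {R : realType} {p : nat} (phi : R -> R) (M V : 'M[R]_p) d
    (z : 'cV_p) :
  spectral_decomposition M (V, d) -> (forall i, 0 < phi (d 0 i)) -> z != 0 ->
  0 < (z^T *m mxfun phi M *m z) 0 0.
Proof.
move=> MVd phi_gt0 z0; rewrite (mxfunE phi MVd); have [/= VV _] := MVd.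
rewrite (quadratic_form_spectral _ V (map_mx phi d)) //.
rewrite lt_neqAle sumr_ge0 => [|i _]; last first.
  by rewrite mxE mulr_ge0 ?sqr_ge0 // ltW.
rewrite andbT eq_sym psumr_eq0 => [|i _]; last first.
  by rewrite mxE mulr_ge0 ?sqr_ge0 // ltW.
apply: contra z0 => /allP V0; rewrite -[z]mul1mx -(mulmx1C VV) -mulmxA.
suff -> : V^T *m z = 0 by rewrite mulmx0.
apply/colP => i; rewrite [RHS]mxE; apply/eqP.
have := V0 i (mem_index_enum i).
by rewrite mxE mulf_eq0 gt_eqF //= sqrf_eq0.
Qed.

(** * The block Lanczos relations *)

Lemma unit_block_orthonormal {R : realType} {n N : nat} (w : 'I_N -> 'I_n) :
  injective w -> (unit_block R w)^T *m unit_block R w = 1%:M.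
Proof.
move=> w_inj; apply/matrixP => i j; rewrite !mxE (bigD1 (w i)) //= big1 => [|k kw].
  by rewrite !mxE eqxx mul1r addr0 (inj_eq w_inj).
by rewrite !mxE (negPf kw) mul0r.
Qed.

Section LanczosRun.
Context {R : realType} {n N m : nat} {L : 'M[R]_n} {E : 'M[R]_(n, N)}
  {Q : nat -> 'M[R]_(n, N)} {H : nat -> nat -> 'M[R]_N}.
Context (L_sym : L^T = L) (EE : E^T *m E = 1%:M).
Context (run : block_lanczos L E m Q H) (H_nb : no_breakdown m H).

Lemma lanczos_recurrence k : (1 <= k < m)%N ->
  L *m Q k = Q k.-1 *m H k.-1 k + Q k *m H k k + Q k.+1 *m H k.+1 k.
Proof.
move=> km; have [/esym QE _ _] := bl_qr run km.
by rewrite QE -[X in _ + X]addrA -opprD [RHS]addrC subrK.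
Qed.

Lemma gram_mul (i j : nat) A :
  (Q i)^T *m Q j = ((i == j) && (0 < i)%N)%:R%:M ->
  (Q i)^T *m (Q j *m A) = A *+ ((i == j) && (0 < i)%N) :> 'M[R]_N.
Proof. by move=> G; rewrite mulmxA G mul_scalar_mx scaler_nat. Qed.

(** By induction on the number of blocks. A new block times its invertible
    triangular factor is the residual [X] of the recurrence, so it is enough
    that every earlier block be orthogonal to [X]. For the last one this is
    the choice of the diagonal coefficient; for an earlier block [Q i],
    symmetry moves [L] to [Q i], where the recurrence at [i] leaves only the
    term that the superdiagonal coefficient subtracts. The factor [(0 < i)]
    accounts for the zero block that precedes the first one: it lets index [0]
    obey the same rule, so that the recurrence needs no special case at its
    start. *)
Lemma lanczos_gram i j : (i <= m)%N -> (j <= m)%N ->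
  (Q i)^T *m Q j = ((i == j) && (0 < i)%N)%:R%:M.
Proof.
suff gram k : (k <= m)%N -> forall i j, (i <= k)%N -> (j <= k)%N ->
    (Q i)^T *m Q j = ((i == j) && (0 < i)%N)%:R%:M.
  by move=> im jm; apply: (gram (maxn i j)); rewrite ?leq_maxl ?leq_maxr ?geq_max ?im.
move=> {i j}; elim: k => [_ i j|k IHk km].
  by rewrite !leqn0 => /eqP-> /eqP->; rewrite (bl_Q0 run) mulmx0 raddf0.
have {}IHk := IHk (ltnW km).
have norm_new : (Q k.+1)^T *m Q k.+1 = 1%:M.
  case: (posnP k) => [->|k_gt0]; first by rewrite (bl_Q1 run).
  have kin : (1 <= k < m)%N by rewrite k_gt0.
  by have [] := bl_qr run kin.
have orth_new i : (i <= k)%N -> (Q i)^T *m Q k.+1 = 0.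
  move=> ik; case: (posnP i) => [->|i_gt0]; first by rewrite (bl_Q0 run) trmx0 mul0mx.
  have k_gt0 : (0 < k)%N by exact: leq_trans ik.
  have kin : (1 <= k < m)%N by rewrite k_gt0.
  have [XE _ _] := bl_qr run kin.
  suff: (Q i)^T *m (Q k.+1 *m H k.+1 k) = 0.
    by move/(congr1 (mulmx^~ (invmx (H k.+1 k)))); rewrite mulmxA mulmxK ?H_nb // mul0mx.
  rewrite -XE.
  move: ik; rewrite leq_eqVlt => /orP[/eqP ik|ik].
    rewrite ik mulmxBr -(bl_diag run) ?k_gt0 ?(ltnW km) //.
    by rewrite (gram_mul _ _ (H k k) (IHk k k _ _)) // eqxx k_gt0 subrr.
  rewrite !mulmxBr (gram_mul _ _ (H k k) (IHk i k _ _)) ?(ltnW ik) //.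
  rewrite (ltn_eqF ik) subr0 (gram_mul _ _ _ (IHk i k.-1 _ _)) ?leq_pred ?(ltnW ik) //.
  have iin : (1 <= i < m)%N by rewrite i_gt0 (ltn_trans ik).
  rewrite mulmxA -{1}L_sym -trmx_mul (lanczos_recurrence i iin).
  rewrite !linearD /= !mulmxDl !trmx_mul -!mulmxA.
  rewrite !IHk ?(leq_trans (leq_pred _)) ?(ltnW ik) // !mul_mx_scalar.
  rewrite (ltn_eqF ik) (ltn_eqF (leq_ltn_trans (leq_pred _) ik)) !scale0r !add0r.
  rewrite i_gt0 !andbT -[k in _ == k]prednK // eqSS scaler_nat.
  have [ik1|_] := eqVneq i k.-1; last by rewrite subrr.
  have iS : i.+1 = k by rewrite ik1 prednK.
  by rewrite -iS /= (bl_super run) // subrr.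
move=> i j; rewrite (leq_eqVlt i) (leq_eqVlt j) !ltnS.
move=> /orP[/eqP->|ik] /orP[/eqP->|jk].
- by rewrite eqxx norm_new.
- by rewrite -[LHS]trmxK trmx_mul trmxK orth_new // trmx0 gtn_eqF //= raddf0.
- by rewrite orth_new // ltn_eqF //= raddf0.
- exact: IHk.
Qed.

(** The recurrence gives every block column but the last, for which it would
    involve a block that is not generated. There the off-diagonal blocks follow
    by symmetry and the diagonal one from its definition. *)
Lemma lanczos_projection i j : (1 <= i <= m)%N -> (1 <= j <= m)%N ->
  (Q i)^T *m L *m Q j =
    if [|| i == j, i == j.+1 | j == i.+1] then H i j else 0.
Proof.
have proj k l : (1 <= k <= m)%N -> (1 <= l < m)%N -> (Q k)^T *m L *m Q l =
    if [|| k == l, k == l.+1 | l == k.+1] then H k l else 0.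
  case/andP=> k_gt0 km lin; have /andP[l_gt0 lm] := lin.
  have l1m : (l.-1 <= m)%N by rewrite (leq_trans (leq_pred _)) ?(ltnW lm).
  rewrite -mulmxA lanczos_recurrence // !mulmxDr.
  rewrite (gram_mul _ _ _ (lanczos_gram k l.-1 km l1m)).
  rewrite (gram_mul _ _ _ (lanczos_gram k l km (ltnW lm))).
  rewrite (gram_mul _ _ _ (lanczos_gram k l.+1 km lm)) k_gt0 !andbT.
  case: l l_gt0 {lin lm l1m} => // l _ /=; rewrite eqSS [l == k]eq_sym.
  have [->|kl] := eqVneq k l; first by rewrite (ltn_eqF (ltnSn l)) ltn_eqF ?addr0 // leqW.
  have [->|kl1] := eqVneq k l.+1; first by rewrite ltn_eqF // add0r addr0.
  by have [->|kl2] := eqVneq k l.+2; rewrite ?add0r ?addr0.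
move=> iin jin; have /andP[i_gt0 im] := iin; have /andP[j_gt0] := jin.
rewrite leq_eqVlt => /orP[/eqP jm|jm]; last by apply: proj; rewrite ?j_gt0.
move: im; rewrite leq_eqVlt => /orP[/eqP im|im].
  have ij : i = j by rewrite im jm.
  rewrite ij eqxx /= (bl_diag run jin) mulmxBr mulmxA.
  rewrite (gram_mul _ _ _ (lanczos_gram _ _ _ _)) -?jm ?leq_pred //.
  by rewrite gtn_eqF ?prednK //= subr0.
have -> : (Q i)^T *m L *m Q j = ((Q j)^T *m L *m Q i)^T.
  by rewrite !trmx_mul trmxK L_sym mulmxA.
rewrite proj ?i_gt0 //.
rewrite jm (ltn_eqF im) (gtn_eqF im) (ltn_eqF (leqW im)) orbF /=.
case: eqP => [mi|_]; last by rewrite trmx0.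
by rewrite mi (bl_super run) // i_gt0 im.
Qed.

Lemma lanczos_basis_orthonormal : (lanczos_basis m Q)^T *m lanczos_basis m Q = 1%:M.
Proof.
rewrite /lanczos_basis tr_mxrow mul_mxcol_mxrow.
rewrite -mxdiagZ /mxdiag; apply: eq_mxblock => i j.
rewrite lanczos_gram // eqSS andbT (val_eqE i j).
by case: eqVneq => _; rewrite ?conform_mx_id ?raddf0.
Qed.

Lemma lanczos_tridiagE :
  lanczos_tridiag m H = (lanczos_basis m Q)^T *m L *m lanczos_basis m Q.
Proof.
rewrite /lanczos_basis tr_mxrow mxcol_mul mul_mxcol_mxrow.
by apply: eq_mxblock => i j; rewrite lanczos_projection ?ltn_ord // !eqSS.
Qed.

Lemma lanczos_basis_first_block : (1 <= m)%N -> lanczos_basis m Q *m first_block R N m = E.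
Proof.
move=> m_gt0; rewrite /lanczos_basis /first_block mul_mxrow_mxcol.
rewrite (bigD1 (Ordinal m_gt0)) //= mulmx1 (bl_Q1 run) big1 ?addr0 // => i i0.
by rewrite ifN ?mulmx0 //; apply: contra i0 => /eqP i0; apply/eqP/val_inj.
Qed.

Lemma first_blockE : (1 <= m)%N -> first_block R N m = (lanczos_basis m Q)^T *m E.
Proof.
by move/lanczos_basis_first_block <-; rewrite mulmxA lanczos_basis_orthonormal mul1mx.
Qed.

End LanczosRun.

(** * The RLS predictor *)

Theorem corollary1 (R : realType) (n N m : nat) (L : 'M[R]_n) (Lambda : R)
    (phi : R -> R) (w : 'I_N -> 'I_n) (y : 'cV[R]_N) (gamma : R)
    (Q : nat -> 'M[R]_(n, N)) (H : nat -> nat -> 'M[R]_N)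
    (L_sym : L^T = L)
    (Lambda_gt0 : 0 < Lambda)
    (L_spec : forall a : R, eigenvalue L a -> 0 <= a <= Lambda)
    (phi_gt0 : forall x : R, 0 <= x <= Lambda -> 0 < phi x)
    (w_inj : injective w)
    (m_ge1 : (1 <= m)%N)
    (gamma_ge0 : 0 <= gamma)
    (QH_run : block_lanczos L (unit_block R w) m Q H)
    (H_nb : no_breakdown m H) :
  let E := unit_block R w in
  let P := cbl_output m phi Q H in
  [/\ exists! c : 'cV[R]_N, rls_coefficients E P gamma y c,
      exists! u : 'cV[R]_n, rls_predictor E P gamma y u
    & forall (c : 'cV[R]_N) (u : 'cV[R]_n),
        rls_coefficients E P gamma y c -> u = P *m c ->
        let b := mxfun phi (lanczos_tridiag m H) *m first_block R N m *m c in
        u = lanczos_basis m Q *m b /\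
        u = \sum_j b j 0 *: col j (lanczos_basis m Q)].
Proof.
move=> E P.
have EE : E^T *m E = 1%:M := unit_block_orthonormal w w_inj.
pose B := lanczos_basis m Q; pose T := lanczos_tridiag m H.
have BB : B^T *m B = 1%:M := lanczos_basis_orthonormal L_sym EE QH_run H_nb.
have TE : T = B^T *m L *m B := lanczos_tridiagE L_sym EE QH_run H_nb.
have FE : first_block R N m = B^T *m E := first_blockE L_sym EE QH_run H_nb m_ge1.
have BF : B *m first_block R N m = E := lanczos_basis_first_block QH_run m_ge1.
have Tsym : T^T = T by rewrite TE !trmx_mul trmxK L_sym mulmxA.
have [[V d] TVd] := symmetric_spectral_decomposition T Tsym.
have phi_d i : 0 < phi (d 0 i).
  by apply/phi_gt0/(compression_spectrum L B 0 Lambda V d i) => //; rewrite -TE.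
pose A := E^T *m P + (gamma * N%:R)%:M.
(* The kernel is trivial because v A v^T > 0 for every nonzero row v. *)
have A_unit : A \in unitmx.
  rewrite -unitmx_tr -row_free_unit; apply: inj_row_free => v vA.
  have {}vA : A *m v^T = 0 by rewrite -[LHS]trmxK trmx_mul trmxK vA trmx0.
  apply/eqP/negP => /negP v0.
  have Fv0 : first_block R N m *m v^T != 0.
    apply: contra v0 => /eqP Fv0.
    rewrite -trmx_eq0 -[v^T]mul1mx -EE -{2}BF -!mulmxA.
    by rewrite Fv0 !mulmx0.
  have := mxfun_quadratic_form_gt0 phi T V d _ TVd phi_d Fv0; apply/negP; rewrite -leNgt.
  have EB : E^T *m B = (first_block R N m)^T by rewrite FE trmx_mul trmxK.
  have vAv : v *m A *m v^T = (first_block R N m *m v^T)^T *m mxfun phi T *m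
      (first_block R N m *m v^T) + (gamma * N%:R) *: (v *m v^T).
    rewrite /A mulmxDr mulmxDl mul_mx_scalar scalemxAl /P /cbl_output -/B -/T.
    by rewrite !mulmxA -[v *m _ *m B]mulmxA EB trmx_mul trmxK.
  have := congr1 (fun X : 'M[R]_1 => X 0 0) vAv.
  rewrite -mulmxA vA mulmx0 !mxE => /esym/eqP; rewrite addr_eq0 => /eqP ->.
  rewrite oppr_le0 mulr_ge0 ?mulr_ge0 ?ler0n //.
  rewrite sumr_ge0 // => i _; rewrite mxE; exact: sqr_ge0.
have coef c : rls_coefficients E P gamma y c <-> c = invmx A *m y.
  rewrite /rls_coefficients -/A; split=> [<-|->]; first by rewrite mulKmx.
  by rewrite mulKVmx.
split.
- exists (invmx A *m y); split=> [|c /coef->//]; exact/coef.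
- exists (P *m (invmx A *m y)); split=> [|u [c /coef-> ->//]].
  by exists (invmx A *m y) => //; exact/coef.
- move=> c u _ uE b; have uB : u = B *m b by rewrite uE /P /cbl_output /b !mulmxA.
  split=> //; rewrite {1}uB; apply/colP => i; rewrite mxE summxE.
  by apply: eq_bigr => j _; rewrite !mxE mulrC.
Qed.
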